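(* The group $$G=\langle x_1,x_2 : x_1^4=x_2^2=(x_1x_2)^4=(x_1^2x_2)^4=1\rangle$$ has exponent $4$ and nilpotency class $4$, and $G$ is not realizable in characteristic $2$, i.e. there is no ring $R$ of characteristic $2$ with $R^\times\cong G$.
   Context: All rings are associative and unital; $R^\times$ denotes the group of units of the ring $R$. The group $G$ is the group of order $64$ identified as SmallGroup(64,34) in the GAP small groups library. *)

(* Defs.v *)
From mathcomp Require Import all_boot all_algebra.
From mathcomp Require Import all_fingroup all_solvable.

Set Implicit Arguments.
Unset Strict Implicit.
Unset Printing Implicit Defensive.

Import GRing.Theory.
Local Open Scope ring_scope.

(* Units are defined here for an arbitrary (possibly infinite) ring, since     *)
(* [GRing.unit] is only available when invertibility is decidable.             *)
Definition invertible (R : nzRingType) (u : R) : Prop :=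
  exists v : R, v * u = 1 /\ u * v = 1.

(* R^* is isomorphic to G: a multiplicative bijection from G onto the units.   *)
Definition units_isog (R : nzRingType) (gT : finGroupType) (G : {group gT}) :
    Prop :=
  exists f : gT -> R,
    [/\ {in G &, {morph f : x y / (x * y)%g >-> x * y}},
        {in G &, injective f}
      & forall u : R, invertible u <-> exists2 x, x \in G & f x = u].

(* The zero ring has characteristic 1, so restricting to nonzero rings loses   *)
(* nothing when p is prime.                                                    *)
Definition realizable_in_char (p : nat) (gT : finGroupType) (G : {group gT}) :
    Prop :=
  exists R : nzRingType, p \in [pchar R] /\ units_isog R G.

(* Main.v *)
Require Import Defs.
From HB Require Import structures.
From mathcomp Require Import all_boot all_algebra.
From mathcomp Require Import all_fingroup all_solvable.

(* G is the semidirect product Z[i]/4 ><| <i>: in terms of the generators, i *)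
(* is x1, translation by 1 is t = x1^2 x2, and translation by i is *)
(* s = x1 t x1^-1. *)
(*   Suppose that G is the unit group of a ring R of characteristic 2. A sum *)
(* of elements of G whose fourth power is 1 lies in G, so the commutation *)
(* properties of such a sum locate it inside G. First, t^3 s + t s + t^2 is an *)
(* involution or 1 centralizing t and s, hence one of 1, t^2, s^2, t^2 s^2; *)
(* all values but 1 are contradictory. From t^3 s + t s + t^2 = 1 it follows *)
(* that e = 1 + t + s and g = 1 + (t + s)(1 + x1) are in G, that e centralizes *)
(* t and s, that e^2 = t^2 s^2, and that g commutes with e. In G this forces *)
(* g to commute with t, but g t + t g = (t^2 + s^2) x1 is nonzero. *)

Set Implicit Arguments.
Unset Strict Implicit.
Unset Printing Implicit Defensive.

Import GRing.Theory.

(** The presented group maps onto the semidirect product and has order at most 64, so the two are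
    isomorphic ([isog_rot_group]). Exponent and class are computed in the model; the class is the
    nilpotency index of 1 - i modulo 4. For the unit group, [f] extends to a ring morphism from
    F_2[G] to R, and identities in R are deduced from known ones by computing in F_2[G]
    ([eq_gsum_mod]). [sum_shift_relation] and then [rot_group_not_units] force sums to be elements
    of G until [f] would identify two of them. *)

Definition plane := ('Z_4 * 'Z_4)%type.

Definition quarter_turn (v : plane) : plane := (- v.2, v.1)%R.

Definition rot (k : 'Z_4) (v : plane) : plane := iter k quarter_turn v.

Lemma quarter_turnD : {morph quarter_turn : v w / (v + w)%R}.
Proof. by move=> v w; rewrite /quarter_turn /= opprD. Qed.

Lemma rotD k : {morph rot k : v w / (v + w)%R}.
Proof.
move=> v w; rewrite /rot; elim: (k : nat) => //= n ->.
exact: quarter_turnD.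
Qed.

Lemma iter_quarter_turn4 v : iter 4 quarter_turn v = v.
Proof. by case: v => x y; rewrite /= /quarter_turn /= !opprK. Qed.

Lemma iter_quarter_turn_mod n v :
  iter (n %% 4) quarter_turn v = iter n quarter_turn v.
Proof.
rewrite [in RHS](divn_eq n 4) addnC iterD; congr iter.
by elim: (n %/ 4) => // k IHk; rewrite mulSn iterD -IHk iter_quarter_turn4.
Qed.

Lemma rot_add (k l : 'Z_4) v : rot (k + l)%R v = rot k (rot l v).
Proof. rewrite /rot -iterD; exact: iter_quarter_turn_mod. Qed.

(* A pair (v, k) stands for the affine map w |-> i^k w + v of Z[i]/4. *)
Definition rot_group := (plane * 'Z_4)%type.

HB.instance Definition _ := Finite.on rot_group.

Definition rot_mul (g h : rot_group) : rot_group :=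
  ((g.1 + rot g.2 h.1)%R, (g.2 + h.2)%R).
Definition rot_one : rot_group := (0%R, 0%R).
Definition rot_inv (g : rot_group) : rot_group :=
  ((- rot (- g.2) g.1)%R, (- g.2)%R).

Lemma rot_mulA : associative rot_mul.
Proof.
move=> [u j] [v k] [w l]; congr (_, _); rewrite /= ?addrA //.
by rewrite rotD rot_add addrA.
Qed.

Lemma rot_mul1g : left_id rot_one rot_mul.
Proof. by case=> v k; rewrite /rot_mul /= !add0r. Qed.

Lemma rot_mulVg : left_inverse rot_one rot_inv rot_mul.
Proof. by case=> v k; rewrite /rot_mul /= !addNr. Qed.

HB.instance Definition _ :=
  Finite_isGroup.Build rot_group rot_mulA rot_mul1g rot_mulVg.

Local Open Scope group_scope.

Definition shift1 : rot_group := ((1%R, 0%R), 0%R).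
Definition shifti : rot_group := ((0%R, 1%R), 0%R).
Definition turn : rot_group := (0%R, 1%R).

Local Notation t := shift1.
Local Notation s := shifti.
Local Notation a := turn.
Local Notation z := (t ^+ 2 * s ^+ 2).

Definition Z4_elts : seq 'Z_4 := [:: 0%R; 1%R; 2%:R%R; 3%:R%R].
Definition rot_elts : seq rot_group :=
  [seq (v, k) | v <- [seq (x, y) | x <- Z4_elts, y <- Z4_elts], k <- Z4_elts].

Lemma rot_group_all (P : pred rot_group) : all P rot_elts -> forall g, P g.
Proof.
have Z4P (k : 'Z_4) : k \in Z4_elts by case: k => [[|[|[|[|]]]]].
by move/allP=> allP [[x y] k]; apply: allP; rewrite !allpairs_f ?Z4P.
Qed.

Lemma rot_group_all2 (P : rel rot_group) :
  all (fun g => all (P g) rot_elts) rot_elts -> forall g h, P g h.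
Proof.
by move=> allP g; apply: rot_group_all; move: g; apply: rot_group_all.
Qed.

(** * Order, exponent and nilpotency class of the model *)

Lemma card_rot_group : #|[set: rot_group]| = 64.
Proof. by rewrite cardsT !card_prod !card_ord. Qed.

Lemma rot_group_exponent : exponent [set: rot_group] = 4.
Proof.
have e4 : exponent [set: rot_group] %| 4.
  apply/exponentP=> g _; apply/eqP; move: g.
  by apply: rot_group_all; vm_compute.
have : ~~ (exponent [set: rot_group] %| 2).
  by apply/exponentP=> /(_ a (in_setT _)) /eqP.
by case: (exponent _) e4 (dvdn_leq (isT : 0 < 4) e4) => [|[|[|[|[|]]]]].
Qed.

(* The terms of the lower central series are (1 - i)^n Z[i]/4, here described *)
(* as the kernels of (1 - i)^(4 - n). *)
Definition shift_kernel n : {set rot_group} :=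
  [set g | (g.2 == 0%R) && (iter n (fun v => v - quarter_turn v)%R g.1 == 0%R)].

Lemma shift_kernel_group_set n : group_set (shift_kernel n).
Proof.
have dD (v w : plane) : iter n (fun v => v - quarter_turn v)%R (v + w)%R
    = (iter n (fun v => v - quarter_turn v) v
       + iter n (fun v => v - quarter_turn v) w)%R.
  elim: n => //= n ->; rewrite quarter_turnD.
  by rewrite opprD addrACA.
have d0 : iter n (fun v : plane => v - quarter_turn v)%R 0%R = 0%R.
  by apply: (addIr (iter n (fun v : plane => v - quarter_turn v)%R 0%R));
     rewrite -dD !add0r.
apply/group_setP; split=> [|[v k] [w l]]; first by rewrite inE /= d0 !eqxx.
rewrite !inE /= => /andP[/eqP-> /eqP dv] /andP[/eqP-> /eqP dw].
by rewrite dD dv dw !addr0 !eqxx.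
Qed.

Canonical shift_kernel_group n := group (shift_kernel_group_set n).

(** Commutators are translations by multiples of 1 - i, killed by (1 - i)^3 because (1 - i)^4 = -4;
    each further commutator gains a factor 1 - i. *)
Lemma lcn_rot_group n :
  n < 4 -> 'L_n.+2([set: rot_group]) \subset shift_kernel (3 - n).
Proof.
have step m : m < 3 ->
    forall g h, g \in shift_kernel m.+1 -> [~ g, h] \in shift_kernel m.
  move=> m3 g h; apply/implyP; rewrite !inE; move: g h.
  by apply: rot_group_all2; case: m m3 => [|[|[|]]] // _; vm_compute.
elim: n => [|n IHn] n4; rewrite lcnSn gen_subG;
  apply/subsetP=> _ /imset2P[g h Hg _ ->].
  by rewrite inE; move: g h {Hg}; apply: rot_group_all2; vm_compute.
apply: step; last by rewrite -subSn //; apply: subsetP (IHn (ltnW n4)) _ Hg.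
by rewrite ltn_subrL.
Qed.

Lemma rot_group_nilpotent : nilpotent [set: rot_group].
Proof. by apply: (pgroup_nil (p := 2)); rewrite /pgroup card_rot_group. Qed.

Lemma rot_group_nil_class : nil_class [set: rot_group] = 4.
Proof.
have nilK := rot_group_nilpotent.
have le4 : nil_class [set: rot_group] <= 4.
  apply/(lcn_nil_classP _ nilK)/trivgP.
  apply: subset_trans (lcn_rot_group (isT : 3 < 4)) _.
  apply/subsetP=> [[v k]]; rewrite !inE /= => /andP[/eqP-> /eqP->]; exact: eqxx.
have : ~~ (nil_class [set: rot_group] <= 3).
  apply/(lcn_nil_classP _ nilK) => L4.
  (* Up to a unit, this is translation by (1 - i)^3 = -2 - 2i, nonzero modulo 4. *)
  have: [~ t, a, a, a] \in 'L_4([set: rot_group]).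
    by rewrite !lcnSn !mem_commg ?inE.
  by rewrite L4 inE.
by case: (nil_class _) le4 => [|[|[|[|[|]]]]].
Qed.

(** * Identification with the presented group *)

Lemma rot_group_hom :
  [set: rot_group] \homg Grp (x1 : x2 :
       x1 ^+ 4 = 1, x2 ^+ 2 = 1, (x1 * x2) ^+ 4 = 1, (x1 ^+ 2 * x2) ^+ 4 = 1).
Proof.
(* The second generator is chosen so that x1^2 x2 becomes [t]. *)
apply/existsP; exists (a, a ^+ 2 * t); apply/eqP; congr (_, _);
  last by apply/eqP.
apply/eqP; rewrite eqEsubset subsetT; apply/subsetP=> g _ /=.
set A := _ <*> _.
have Aa : a \in A by rewrite mem_gen // inE cycle_id.
have At : t \in A.
  have -> : t = a ^+ 2 * (a ^+ 2 * t) by apply/eqP.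
  by rewrite groupM ?groupX // mem_gen // inE cycle_id orbT.
have As : s \in A.
  by have -> : s = a * t * a^-1; [apply/eqP | rewrite !groupM ?groupV].
suff -> : g = t ^+ g.1.1 * s ^+ g.1.2 * a ^+ g.2 by rewrite !groupM ?groupX.
by apply/eqP; move: g; apply: rot_group_all; vm_compute.
Qed.

Lemma isog_rot_group (gT : finGroupType) (G : {group gT}) :
  G \isog Grp (x1 : x2 :
       x1 ^+ 4 = 1, x2 ^+ 2 = 1, (x1 * x2) ^+ 4 = 1, (x1 ^+ 2 * x2) ^+ 4 = 1) ->
  [set: rot_group] \isog G.
Proof.
move=> presG; have homK := rot_group_hom.
rewrite isogEcard presG homK /= card_rot_group.
have /existsP[[x y]] := isoGrp_hom presG.
rewrite /= !xpair_eqE => /and5P[/eqP defG /eqP x4 /eqP y2 /eqP xy4 /eqP t4].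
have yV : y^-1 = y by apply: (mulgI y); rewrite mulgV -expg2 y2.
have xV : x * x * x = x^-1.
  by apply: (mulgI x); rewrite mulgV -x4 !expgS expg0 mulg1 !mulgA.
(* These play the roles of [t] and [s]. The relation (x y)^4 = 1 makes them commute, and x permutes
   their cyclic groups, so G is the product of three cyclic groups of order at most 4. *)
pose u := x ^+ 2 * y; pose v := x^-1 * y * x^-1.
have xy2 : x * y * (x * y) = y * x^-1 * (y * x^-1).
  apply: (mulgI (x * y * (x * y))).
  have -> : x * y * (x * y) * (x * y * (x * y)) = 1.
    by rewrite -xy4 !expgS expg0 mulg1 !mulgA.
  by rewrite !mulgA -{3 4}yV !mulgK mulgV.
have cuv : commute u v.
  rewrite /commute /u /v expg2.
  transitivity (x * x * (x * y * (x * y))); first by rewrite xy2 !mulgA.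
  by rewrite !mulgA mulgKV xV.
have vE : v = u ^ x^-1 by rewrite conjgE invgK /u /v expg2 !mulgA xV.
have uVE : u^-1 = v ^ x^-1.
  by rewrite conjgE invgK /u /v expg2 !invMg !mulgA mulgV mul1g yV.
pose M := <[u]> <*> <[v]>.
have nMx : <[x]> \subset 'N(M).
  rewrite cycle_subG -groupV inE /M conjYg -!cycleJ -vE -uVE cycleV.
  by rewrite joingC.
have sGM : G \subset M * <[x]>.
  rewrite -norm_joinEr // -defG join_subG joing_subr cycle_subG.
  have -> : y = x ^- 2 * u by rewrite mulKg.
  have [Mu Mx] : u \in M <*> <[x]> /\ x \in M <*> <[x]>.
    by rewrite !mem_gen // inE ?cycle_id ?orbT // mem_gen // inE cycle_id.
  by rewrite groupM ?groupV ?groupX.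
have leM (A B : {group gT}) : #|A * B| <= #|A| * #|B|.
  by rewrite mul_cardG leq_pmulr ?cardG_gt0.
have le4 (w : gT) : w ^+ 4 = 1 -> #|<[w]>| <= 4.
  by move/eqP; rewrite -order_dvdn => /dvdn_leq; apply.
have u4 : u ^+ 4 = 1 by [].
have v4 : v ^+ 4 = 1 by rewrite vE -conjXg u4 conj1g.
have ME : M = <[u]> * <[v]> by apply: cent_joinEr; apply: cents_cycle.
have M16 : #|M| <= 4 * 4.
  by rewrite ME; apply: leq_trans (leM _ _) (leq_mul (le4 _ u4) (le4 _ v4)).
apply: leq_trans (subset_leq_card sGM) (leq_trans (leM _ _) _).
exact: leq_mul M16 (le4 _ x4).
Qed.

(** * Centralizers in the model *)

Lemma involution_centralizing_shifts k :
  [&& k * t == t * k, k * s == s * k & k * k == 1]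
    ==> (k \in [:: 1; t ^+ 2; s ^+ 2; z]).
Proof. by move: k; apply: rot_group_all; vm_compute. Qed.

(** The rotation part of h fixes 2, so it is 1 or -1. *)
Lemma centralizer_square_shift1 h :
  (h * t ^+ 2 == t ^+ 2 * h) ==> (h * t == t * h) || (h * t == t ^+ 3 * h).
Proof. by move: h; apply: rot_group_all; vm_compute. Qed.

(** Here e is a translation with both coordinates odd; no nontrivial power of i fixes it, so g is a
    translation. *)
Lemma centralizer_sqrt_central_shift e g :
  [&& e * t == t * e, e * s == s * e, e * e == z & g * e == e * g]
    ==> (g * t == t * g).
Proof. by move: e g; apply: rot_group_all2; vm_compute. Qed.

(** * Computing in R through the group algebra over F_2 *)

Section UnitGroupOfChar2.

Local Open Scope ring_scope.

Variables (R : nzRingType) (f : rot_group -> R).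
Hypotheses (pchar2 : 2 \in [pchar R])
  (fM : forall g h, f (g * h)%g = f g * f h) (f_inj : injective f)
  (f_units : forall u, invertible u <-> exists g, f g = u).

Let addRR (u : R) : u + u = 0. Proof. exact: addrr_pchar2. Qed.

Let f1 : f 1%g = 1.
Proof.
have [v [vf _]] : invertible (f 1%g) by apply/f_units; exists 1%g.
by rewrite -[LHS]mul1r -vf -mulrA -fM mulg1 vf.
Qed.

(** A list stands for an element of F_2[G], and [gsum] is its image in R. *)
Definition gsum (l : seq rot_group) : R := \sum_(g <- l) f g.

Lemma gsum1 g : gsum [:: g] = f g. Proof. exact: big_seq1. Qed.

Lemma gsumD l m : gsum l + gsum m = gsum (l ++ m).
Proof. by rewrite /gsum big_cat. Qed.

Definition gmul (l m : seq rot_group) := [seq (g * h)%g | g <- l, h <- m].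

Lemma gsumM l m : gsum l * gsum m = gsum (gmul l m).
Proof.
rewrite /gsum big_allpairs_dep big_distrlr /=.
by apply: eq_bigr => g _; apply: eq_bigr => h _; rewrite fM.
Qed.

Lemma gsum_count l : gsum l = \sum_g f g *+ odd (count_mem g l).
Proof.
rewrite /gsum; elim: l => [|h l IHl]; first by rewrite big_nil big1.
rewrite big_cons IHl (bigD1 h) //= [RHS](bigD1 h) //= eqxx add1n addrA.
congr (_ + _); last by apply: eq_bigr => g /negPf; rewrite eq_sym => ->.
by rewrite oddS; case: (odd _); rewrite !(mulr1n, mulr0n) ?addRR ?addr0.
Qed.

Definition same_parity (l m : seq rot_group) :=
  all (fun g => odd (count_mem g l) == odd (count_mem g m)) (l ++ m).

Lemma eq_gsum l m : same_parity l m -> gsum l = gsum m.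
Proof.
move/allP=> eq_lm; rewrite !gsum_count; apply: eq_bigr => g _.
have [/eq_lm/eqP-> //|] := boolP (g \in l ++ m).
by rewrite mem_cat negb_or => /andP[/count_memPn-> /count_memPn->].
Qed.

Lemma unit_of_exponent4 (u : R) : u * u * (u * u) = 1 -> exists g, f g = u.
Proof.
move=> u4; apply/f_units; exists (u * u * u).
by split; rewrite -?mulrA // mulrA.
Qed.

(* The identity x = y is the relation l = m multiplied by p and q, up to *)
(* cancellations in the group algebra over F_2, which are decided by *)
(* computation. *)
Lemma eq_gsum_mod p q l m x y : gsum l = gsum m ->
    same_parity (x ++ gmul p (gmul l q)) (y ++ gmul p (gmul m q)) ->
  gsum x = gsum y.
Proof.
by move=> eq_lm /eq_gsum; rewrite -!gsumD -!gsumM eq_lm => /addIr.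
Qed.
Arguments eq_gsum_mod p q [l m x y].

Lemma commute_of_gsum g h l : f g = gsum l ->
  gsum (gmul l [:: h]) = gsum (gmul [:: h] l) -> (g * h == h * g)%g.
Proof.
by move=> fg eq_gh; apply/eqP/f_inj; rewrite !fM -(gsum1 h) fg !gsumM.
Qed.

Local Open Scope group_scope.

Lemma sum_shift_relation : gsum [:: t ^+ 3 * s; t * s; t ^+ 2] = gsum [:: 1].
Proof.
set u := [:: _; _; _].
have u2 : gsum (gmul u u) = gsum [:: 1] by apply: eq_gsum.
have [k fk] : exists k, f k = gsum u.
  by apply: unit_of_exponent4; rewrite gsumM u2 gsum1 f1 mulr1.
have : k \in [:: 1; t ^+ 2; s ^+ 2; z].
  apply: (implyP (involution_centralizing_shifts k)).
  rewrite !(commute_of_gsum fk) /=; try exact: eq_gsum.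
  by apply/eqP/f_inj; rewrite fM fk gsumM u2 gsum1.
rewrite !inE; case/or4P=> /eqP kE; move: fk; rewrite kE -gsum1 => fk //.
- have : gsum [:: t ^+ 3 * s] = gsum [:: t * s].
    exact: (eq_gsum_mod [:: 1] [:: 1] fk).
  by rewrite !gsum1 => /f_inj/eqP.
(* Conjugation by [a] maps t to s and s to t^-1, so it fixes t^2 + s^2 but not the other side. *)
- have e1 : gsum [:: t ^+ 2; s ^+ 2] = gsum [:: t ^+ 3 * s; t * s].
    exact: (eq_gsum_mod [:: 1] [:: 1] fk).
  have e2 : gsum [:: t ^+ 2; s ^+ 2] = gsum [:: s ^+ 3 * t ^+ 3; s * t ^+ 3].
    exact: (eq_gsum_mod [:: a] [:: a^-1] e1).
  have : gsum [:: t * s] = gsum [:: s ^+ 3 * t ^+ 3].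
    exact: (eq_gsum_mod [:: 1] [:: 1] (etrans (esym e1) e2)).
  by rewrite !gsum1 => /f_inj/eqP.
(* In the last case, k = z, consider h = 1 + (1 + t^2)(1 + a): it has *)
(* square 1 and commutes with t^2, so h t is t h or t^3 h. The former gives *)
(* t a = t z a, and the latter 1 + t^2 = (1 + z) a, which is absurd because *)
(* only the right hand side commutes with a. *)
have q0 : gsum [:: 1; t ^+ 2] = gsum [:: s ^+ 2; z].
  exact: (eq_gsum_mod [:: 1] [:: 1; t ^+ 2] fk).
pose v := [:: t ^+ 2; a; t ^+ 2 * a].
have v2 : gsum (gmul v v) = gsum [:: 1].
  exact: (eq_gsum_mod [:: 1] [:: a; a ^+ 2] q0).
have [h fh] : exists h, f h = gsum v.
  by apply: unit_of_exponent4; rewrite gsumM v2 gsum1 f1 mulr1.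
have vt : gsum (gmul v [:: t] ++ [:: t * a; t * z * a]) = gsum (gmul [:: t] v).
  exact: (eq_gsum_mod [:: 1] [:: t * a] fk).
have := implyP (centralizer_square_shift1 h); case/(_ _)/orP.
- apply: (commute_of_gsum fh); exact: (eq_gsum_mod [:: 1] [:: t ^+ 2 * a] q0).
- move/eqP/(congr1 f); rewrite !fM fh -gsum1 !gsumM -vt => e.
  have : gsum [:: t * a] = gsum [:: t * z * a].
    exact: (eq_gsum_mod [:: 1] [:: 1] e).
  by rewrite !gsum1 => /f_inj/eqP.
move/eqP/(congr1 f); rewrite !fM fh -!gsum1 !gsumM => e.
move: vt; rewrite -gsumD e gsumD => vt.
have q1 : gsum [:: t ^+ 2; 1] = gsum [:: a; z * a].
  exact: (eq_gsum_mod [:: t ^+ 3] [:: 1] vt).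
have q2 : gsum [:: t ^+ 2 * a; a] = gsum [:: a ^+ 2; z * a ^+ 2].
  exact: (eq_gsum_mod [:: 1] [:: a] q1).
have q3 : gsum [:: a * t ^+ 2; a] = gsum [:: a ^+ 2; z * a ^+ 2].
  exact: (eq_gsum_mod [:: a] [:: 1] q1).
have : gsum [:: t ^+ 2 * a] = gsum [:: a * t ^+ 2].
  exact: (eq_gsum_mod [:: 1] [:: 1] (etrans q2 (esym q3))).
by rewrite !gsum1 => /f_inj/eqP.
Qed.

Lemma rot_group_not_units : False.
Proof.
have rel := sum_shift_relation.
pose u := [:: 1; t; s]; pose v := [:: 1; t; s; t * a; s * a].
(* The relation times t^2 + t s gives 1 + t^2 + s^2 = z. *)
have u2 : gsum (gmul u u) = gsum [:: z].
  exact: (eq_gsum_mod [:: 1] [:: t ^+ 2; t * s] rel).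
have [e fe] : exists e, f e = gsum u.
  apply: unit_of_exponent4; rewrite gsumM u2 gsumM -f1 -gsum1.
  exact: eq_gsum.
(* This is 1 + (t^2 + s^2)(1 + a^2); it squares to 1 because t^2 + s^2 is central with square t^4 +
   s^4 = 0. *)
pose w := [:: 1; t ^+ 2; s ^+ 2; t ^+ 2 * a ^+ 2; s ^+ 2 * a ^+ 2].
have v2 : gsum (gmul v v) = gsum w.
  exact: (eq_gsum_mod [:: 1] [:: t ^+ 2 * a; t ^+ 2 * a ^+ 2] rel).
have [g fg] : exists g, f g = gsum v.
  apply: unit_of_exponent4; rewrite gsumM v2 gsumM -f1 -gsum1.
  exact: eq_gsum.
have ee : e * e == z by apply/eqP/f_inj; rewrite fM fe gsumM u2 gsum1.
have ge : g * e == e * g.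
  apply/eqP/f_inj; rewrite !fM fe fg !gsumM.
  exact: (eq_gsum_mod [:: 1] [:: t ^+ 2 * a] rel).
have gt : g * t == t * g.
  apply: (implyP (centralizer_sqrt_central_shift e g)).
  by rewrite !(commute_of_gsum fe) ?ee ?ge //=; apply: eq_gsum.
move/eqP/(congr1 f): gt; rewrite !fM fg -(gsum1 t) !gsumM => gt.
have : gsum [:: t ^+ 2 * a] = gsum [:: s ^+ 2 * a].
  exact: (eq_gsum_mod [:: 1] [:: 1] gt).
by rewrite !gsum1 => /f_inj/eqP.
Qed.

End UnitGroupOfChar2.

Theorem mainTheorem4 (gT : finGroupType) (G : {group gT})
    (presG : (G \isog Grp (x1 : x2 :
       x1 ^+ 4 = 1, x2 ^+ 2 = 1, (x1 * x2) ^+ 4 = 1, (x1 ^+ 2 * x2) ^+ 4 = 1))%g) :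
  [/\ exponent G = 4,
      nilpotent G /\ nil_class G = 4
    & ~ realizable_in_char 2 G].
Proof.
have isoK := isog_rot_group presG.
rewrite -(exponent_isog isoK) -(isog_nil isoK) -(isog_nil_class isoK).
rewrite rot_group_exponent rot_group_nilpotent rot_group_nil_class.
split=> // -[R [pchar2 [f [fM f_inj f_units]]]].
have [phi injphi imphi] := isogP isoK.
have phiG g : phi g \in G by rewrite -imphi mem_morphim ?inE.
apply: (@rot_group_not_units R (f \o phi)) => //=.
- by move=> g h; rewrite morphM ?inE // fM.
- move=> g h /f_inj eq_gh; apply: (injmP injphi); rewrite ?inE //.
  exact: eq_gh.
move=> u; split=> [/f_units[x] | [g <-]]; last by apply/f_units; exists (phi g).
by rewrite -imphi => /morphimP[g _ _ ->] <-; exists g.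
Qed.
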